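(* Let $\mathcal T(\bar f,\bar p,J)$ be an iterated function scheme of uniformly contracting $C^{1+\varepsilon}$ diffeomorphisms and let $\mu$ be its stationary measure. Then for every $\alpha$ with $0<\alpha<D_1(\mu)$ there exist $r>0$ and a piecewise constant function $\psi:\mathbb R\to[0,\infty)$ which vanishes outside $B_r(J)$ and which on $B_r(J)$ is positive and bounded away from $0$ and from infinity, such that $$[\mathcal D^{(1)}_{\alpha,\mathcal T}\psi](x)<\psi(x)\qquad\text{for all } x\in B_r(J).$$
   Context: An iterated function scheme $\mathcal T(\bar f,\bar p,J)$ consists of a compact interval $J\subset\mathbb R$, a finite collection $\bar f=(f_1,\dots,f_n)$ of uniformly contracting $C^{1+\varepsilon}$ diffeomorphisms of $\mathbb R$ (for some $\varepsilon>0$; i.e. each $f_j'$ is Hölder continuous of exponent $\varepsilon$, and there is a constant $\theta<1$ with $|f_j'|\le\theta$ for all $j$) with $f_j(J)\subset J$ for all $j$, and a probability vector $\bar p=(p_1,\dots,p_n)$. Its stationary measure is the unique Borel probability measure $\mu$ with $\mu=\sum_{j=1}^n p_j (f_j)_*\mu$. $B_\rho(x)$ is the neighbourhood of radius $\rho$ of the point $x$, and $B_r(J)$ is the closed neighbourhood of radius $r$ of the interval $J$. The asymmetric diffusion operator acts on functions $\psi:\mathbb R\to\mathbb R$ by $$[\mathcal D^{(1)}_{\alpha,\mathcal T}\psi](x)=\sum_{j=1}^n p_j\,|(f_j^{-1})'(x)|^\alpha\,\psi(f_j^{-1}(x)).$$ The Frostman dimension of a compactly supported probability measure $\mu$ on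 $\mathbb R$ is $$D_1(\mu)=\sup\{\alpha\mid \exists C\ \forall x\in\mathbb R\ \forall \rho>0:\ \mu(B_\rho(x))<C\rho^\alpha\}.$$ A function is piecewise constant on an interval if it is constant on each element of some finite partition of that interval into intervals. *)

(* Defs.v *)
From HB Require Import structures.
From mathcomp Require Import all_boot all_order all_algebra.
From mathcomp Require Import all_classical all_reals all_analysis.

Set Implicit Arguments.
Unset Strict Implicit.
Unset Printing Implicit Defensive.

Import Order.TTheory GRing.Theory Num.Theory.
Import numFieldNormedType.Exports.

Local Open Scope classical_set_scope.
Local Open Scope ring_scope.

Definition hoelder_continuous (R : realType) (eps : R) (h : R -> R) : Prop :=
  exists K : R, forall x y : R, `|h x - h y| <= K * `|x - y| `^ eps.

Definition C1 (R : realType) (h : R -> R) : Prop :=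
  (forall x : R, derivable h x 1) /\ continuous (derive1 h).

(* [g] is carried along with [f] because the diffusion operator refers to the
   inverse map; it is determined by [f]. *)
Definition C1_diffeo (R : realType) (f g : R -> R) : Prop :=
  [/\ cancel f g, cancel g f, C1 f & C1 g].

(* [ifs_inv j] is the inverse of [ifs_map j], and the compact interval of
   the scheme is [ifs_left T, ifs_right T]. *)
Record ifscheme (R : realType) := IFScheme {
  ifs_size : nat ;
  ifs_map : 'I_ifs_size -> R -> R ;
  ifs_inv : 'I_ifs_size -> R -> R ;
  ifs_prob : 'I_ifs_size -> R ;
  ifs_left : R ;
  ifs_right : R ;
  ifs_left_le_right : ifs_left <= ifs_right ;
  ifs_diffeo : forall j, C1_diffeo (ifs_map j) (ifs_inv j) ;
  ifs_hoelder : exists2 eps : R, 0 < eps &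
    forall j, hoelder_continuous eps (derive1 (ifs_map j)) ;
  ifs_contracting : exists2 theta : R, theta < 1 &
    forall j (x : R), `|derive1 (ifs_map j) x| <= theta ;
  ifs_invariant : forall j,
    ifs_map j @` `[ifs_left, ifs_right] `<=` `[ifs_left, ifs_right] ;
  ifs_prob_ge0 : forall j, 0 <= ifs_prob j ;
  ifs_prob_sum1 : \sum_(j < ifs_size) ifs_prob j = 1 }.

Definition ifs_interval (R : realType) (T : ifscheme R) : set R :=
  `[ifs_left T, ifs_right T].

(* By Hutchinson's theorem exactly one Borel probability measure satisfies
   this equation. *)
Definition stationary (R : realType) (T : ifscheme R)
    (mu : probability (measurableTypeR R) R) : Prop :=
  forall A : set (measurableTypeR R), measurable A ->
    mu A = (\sum_(j < ifs_size T)
              (ifs_prob j)%:E * pushforward mu (ifs_map j) A)%E.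

Definition closed_neighbourhood (R : realType) (r : R) (A : set R) : set R :=
  [set x | exists2 y, A y & `|x - y| <= r].

Definition diffusion (R : realType) (alpha : R) (T : ifscheme R)
    (psi : R -> R) (x : R) : R :=
  \sum_(j < ifs_size T)
    ifs_prob j * `|derive1 (ifs_inv j) x| `^ alpha * psi (ifs_inv j x).

Definition frostman_exponent (R : realType)
    (mu : probability (measurableTypeR R) R) (alpha : R) : Prop :=
  exists C : R, forall x rho : R, 0 < rho ->
    (mu (ball x rho) < (C * rho `^ alpha)%:E)%E.

Definition frostman_dim (R : realType)
    (mu : probability (measurableTypeR R) R) : \bar R :=
  ereal_sup [set alpha%:E | alpha in frostman_exponent mu].

Definition piecewise_constant_on (R : realType) (I : set R)
    (psi : R -> R) : Prop :=
  exists (m : nat) (F : 'I_m -> set R),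
    [/\ partition setT F I,
        forall i, is_interval (F i) &
        forall i x y, F i x -> F i y -> psi x = psi y].

(* Main.v *)
(* Choose [alpha < gam < beta] with [beta] a Frostman exponent of [mu], let [I]
   be a closed neighbourhood of the interval with [mu I > 0], and consider the
   potential [u x = \int_I k `|x - y| dmu y] of the kernel
   [k t = s^(-gam) exp (- K s^eps)], [s = max t rho].  For [z, y] in [I] put
   [x = f_j z], [t = `|f_j z - f_j y|] and [v = `|z - y|].  The Hoelder condition
   gives the distortion bound [`|(f_j^-1)' x| t <= v exp (L v^eps)]; as
   [t <= theta v], the factor [exp (- K s^eps)] absorbs this distortion once [K] is
   large, so that [`|(f_j^-1)' x|^alpha k v <= theta^(gam - alpha) k t] whenever
   [t >= rho].  Integrating and using stationarity, [D u <= theta^(gam - alpha) u]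
   up to the contribution of [t < rho], which by the Frostman condition is
   [O(rho^(beta - gam))], whereas [u] is bounded below uniformly in [rho].  Hence
   [D u <= l u] with [l < 1] for small [rho], and there is room to replace [u] by a
   step function. *)

Require Import Defs.
From HB Require Import structures.
From mathcomp Require Import all_boot all_order all_algebra.
From mathcomp Require Import all_classical all_reals all_analysis.
From mathcomp Require Import measurable_realfun ring lra.
Import Order.TTheory GRing.Theory Num.Theory.
Import numFieldNormedType.Exports.
Local Open Scope classical_set_scope.
Local Open Scope ring_scope.

(** * Mean value theorem and bounded distortion of the maps *)

(** The distance from [xi] to [z] is recorded because the Hoelder condition will be applied to the
    pair [xi], [z]. *)
Lemma derivable_mean_value (R : realType) (f : R -> R) (A B y z : R) :
  (forall x : R, derivable f x 1) ->
  A <= y <= B -> A <= z <= B ->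
  exists xi : R, [/\ A <= xi <= B, `|xi - y| <= `|y - z|, `|xi - z| <= `|y - z| &
    `|f y - f z| = `|derive1 f xi| * `|y - z|].
Proof.
move=> df; wlog yz : y z / y <= z.
  move=> H yI zI; have [yz|/ltW zy] := leP y z; first exact: H.
  have [xi [xI xz xy e]] := H z y zy zI yI.
  by exists xi; rewrite [`|y - z|]distrC; split=> //; rewrite -e distrC.
move=> yI zI.
have cf : {within `[y, z], continuous f}.
  by apply: derivable_within_continuous => x _; exact: df.
have df' x : x \in `]y, z[ -> is_derive x 1 f (derive1 f x).
  by move=> _; apply: DeriveDef => //; rewrite derive1E.
have [xi xiI e] := MVT_segment yz df' cf.
move: xiI; rewrite in_itv /= => xiI.
exists xi; split; first by lra.
- by rewrite ler_norml; move: (ler_norm (z - y)); rewrite [`|y - z|]distrC; lra.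
- by rewrite ler_norml; move: (ler_norm (z - y)); rewrite [`|y - z|]distrC; lra.
by rewrite distrC e normrM [`|y - z|]distrC.
Qed.

Lemma C1_diffeo_derive1 (R : realType) (f g : R -> R) (z : R) :
  C1_diffeo f g ->
  derive1 f z != 0 /\ derive1 g (f z) = (derive1 f z)^-1.
Proof.
case=> fg _ [df _] [dg _].
have : derive1 (g \o f) z = 1.
  have -> : g \o f = id by apply/funext => x /=; rewrite fg.
  by rewrite derive1E derive_id.
rewrite derive1_comp //.
have [->|f0] := eqVneq (derive1 f z) 0.
  by rewrite mulr0 => /esym/eqP; rewrite oner_eq0.
by move=> e; split=> //; apply: (mulIf f0); rewrite e mulVf.
Qed.

Lemma C1_diffeo_distortion (R : realType) (f g : R -> R) (A B eps theta : R) :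
  C1_diffeo f g -> hoelder_continuous eps (derive1 f) -> 0 < eps ->
  (forall x, `|derive1 f x| <= theta) -> A <= B ->
  exists L G : R, forall L' G' : R, L <= L' -> G <= G' ->
    forall z y : R, A <= z <= B -> A <= y <= B ->
    [/\ `|derive1 g (f z)| * `|f z - f y| <=
          `|z - y| * expR (L' * `|z - y| `^ eps),
        `|derive1 g (f z)| <= G',
        `|z - y| <= G' * `|f z - f y|,
        `|f z - f y| <= theta * `|z - y| &
        1 <= theta * `|derive1 g (f z)|].
Proof.
move=> fg [K hK] eps0 hth AB.
have [_ _ [df cf] _] := fg.
have cnf : {within `[A, B], continuous (fun x => `|derive1 f x|)}.
  apply: continuous_subspaceT => x.
  by apply: (@continuous_comp _ _ _ (derive1 f) Num.norm); [exact: cf|exact: norm_continuous].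
have [m mI hm] := EVT_min AB cnf.
have [m0 _] := C1_diffeo_derive1 R f g m fg.
set c := `|derive1 f m|; have c0 : 0 < c by rewrite normr_gt0.
exists (`|K| / c), c^-1 => L' G' hL hG z y zI yI.
have [fz0 ->] := C1_diffeo_derive1 R f g z fg.
have cz : c <= `|derive1 f z| by apply: hm; rewrite in_itv.
have fz_gt0 : 0 < `|derive1 f z| by rewrite normr_gt0.
have [xi [xiI _ xiz e]] := derivable_mean_value R f A B y z df yI zI.
have cxi : c <= `|derive1 f xi| by apply: hm; rewrite in_itv.
rewrite normfV [`|f z - f y|]distrC e [`|z - y|]distrC.
set u := `|y - z|; have u0 : 0 <= u by exact: normr_ge0.
have c1 : c^-1 * c = 1 by rewrite mulVf // gt_eqF.
have ci0 : 0 < c^-1 by rewrite invr_gt0.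
have Gc : 1 <= G' * c by rewrite -c1 ler_wpM2r // ltW.
split.
- rewrite mulrA [leRHS]mulrC ler_wpM2r //.
  apply: le_trans (expR_ge1Dx _).
  rewrite mulrC ler_pdivrMr //.
  have h1 : `|derive1 f xi| <= `|derive1 f z| + `|K| * u `^ eps.
    have := hK xi z; rewrite -lerBlDl => h.
    apply: (le_trans (lerB_dist _ _)); apply: (le_trans h).
    apply: (@le_trans _ _ (`|K| * `|xi - z| `^ eps)).
      by rewrite ler_wpM2r ?powR_ge0 // ler_norm.
    rewrite ler_wpM2l //; apply: ge0_ler_powR; rewrite ?nnegrE //; exact: ltW.
  apply: (le_trans h1); rewrite mulrDl mul1r lerD2l.
  rewrite mulrAC ler_wpM2r ?powR_ge0 //.
  have : `|K| / c * c <= L' * `|derive1 f z|.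
    apply: ler_pM => //; last exact: ltW.
    by rewrite mulr_ge0 // ltW.
  by rewrite divfK // gt_eqF.
- by apply: le_trans hG; rewrite lef_pV2 ?posrE.
- rewrite mulrA -[leLHS]mul1r ler_wpM2r //; apply: (le_trans Gc).
  by rewrite ler_wpM2l // (le_trans _ hG) // ltW.
- by rewrite ler_wpM2r.
- by rewrite ler_pdivlMr // mul1r.
Qed.

(** * Monotonicity, contraction and slow variation of the kernel *)

(** For [s > 0] this is [s^(-gam) exp (- A s^eps)], with [A] in the role of the damping constant [K]
    of the overview. Written as one exponential, profiles are compared through their exponents. *)
Definition profile (R : realType) (gam A eps s : R) : R :=
  expR (- (gam * ln s + A * s `^ eps)).

Definition kernel (R : realType) (gam A eps rho t : R) : R :=
  profile R gam A eps (Num.max t rho).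

Lemma profile_nincr (R : realType) (gam A eps s s' : R) :
  0 <= gam -> 0 <= A -> 0 <= eps -> 0 < s -> s <= s' ->
  profile R gam A eps s' <= profile R gam A eps s.
Proof.
move=> g0 A0 e0 s0 ss'; have s'0 := lt_le_trans s0 ss'.
rewrite ler_expR lerN2 lerD // ler_wpM2l //.
  by rewrite ler_ln.
by apply: ge0_ler_powR => //; rewrite nnegrE ltW.
Qed.

Lemma profile_le_powR (R : realType) (gam A eps s : R) :
  0 <= A -> 0 < s -> profile R gam A eps s <= s `^ (- gam).
Proof.
move=> A0 s0; rewrite /profile [leRHS]/powR gt_eqF // ler_expR mulNr lerN2 lerDl.
by rewrite mulr_ge0 // powR_ge0.
Qed.

(** In the exponents the distortion costs [gam * L * u^eps], while the two damping terms differ by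
    at least [A (1 - theta^eps) u^eps], because [t^eps <= theta^eps u^eps]. What remains is
    [(gam - alpha) (ln theta + ln a) >= 0], the source of the factor [theta^(gam - alpha)]. *)
Lemma profile_contract (R : realType) (gam A eps alpha theta L a t u : R) :
  0 < eps -> 0 < theta -> 0 <= alpha < gam -> 0 <= A ->
  gam * L <= A * (1 - theta `^ eps) ->
  0 < t -> t <= theta * u -> 1 <= theta * a ->
  a * t <= u * expR (L * u `^ eps) ->
  a `^ alpha * profile R gam A eps u <= theta `^ (gam - alpha) * profile R gam A eps t.
Proof.
move=> eps0 th0 /andP[al0 alg] A0 hA t0 tu tha hat.
have u0 : 0 < u by rewrite -(pmulr_rgt0 _ th0); exact: lt_le_trans tu.
have a0 : 0 < a by rewrite -(pmulr_rgt0 _ th0); exact: lt_le_trans tha.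
have hU : t `^ eps <= theta `^ eps * u `^ eps.
  rewrite -powRM ?(ltW th0) ?(ltW u0) //.
  by apply: ge0_ler_powR; rewrite ?nnegrE ?mulr_ge0 // ltW.
have h1 : 0 <= ln theta + ln a by rewrite -lnM ?posrE // ln_ge0.
have h2 : ln a + ln t <= ln u + L * u `^ eps.
  rewrite -[L * _]expRK -!lnM ?posrE ?expR_gt0 // ler_ln ?posrE //.
    by rewrite mulr_gt0.
  by rewrite mulr_gt0 ?expR_gt0.
rewrite /profile [theta `^ (_ - _)]/powR [a `^ _]/powR !gt_eqF // -!expRD ler_expR.
set U := u `^ eps in hU h2 *; set T := t `^ eps in hU *.
set V := theta `^ eps in hA hU.
have h3 : A * T <= A * (V * U) by rewrite ler_wpM2l.
have U0 : 0 <= U by exact: powR_ge0.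
have h4 : gam * L * U <= A * (1 - V) * U by rewrite ler_wpM2r.
have h5 : gam * (ln a + ln t) <= gam * (ln u + L * U) by rewrite ler_wpM2l //; lra.
have h6 : 0 <= (gam - alpha) * (ln theta + ln a) by rewrite mulr_ge0 //; lra.
nra.
Qed.

(** As [s >= rho], adding at most [delta] multiplies [s] by at most [expR l], which moves the
    exponent by at most [tau * P = ln sigma]. *)
Lemma profile_slowly_varying (R : realType) (gam A eps rho D sigma : R) :
  0 <= gam -> 0 <= A -> 0 < eps -> 0 < rho -> 1 < sigma ->
  exists2 delta : R, 0 < delta & forall s s', rho <= s -> s <= D ->
    s <= s' -> s' <= s + delta ->
    profile R gam A eps s <= sigma * profile R gam A eps s'.
Proof.
move=> g0 A0 e0 r0 sg1.
pose P := gam + A * D `^ eps + 1.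
have P0 : 0 < P by rewrite ltr_wpDl // addr_ge0 // mulr_ge0 // powR_ge0.
have ls0 : 0 < ln sigma by rewrite ln_gt0.
pose tau := ln sigma / P.
have tau0 : 0 < tau by rewrite divr_gt0.
(* The first bound controls the growth of [ln s]; the second gives [expR (l * eps) <= 1 + tau] and
   so controls [s^eps]. *)
pose l := Num.min tau (ln (1 + tau) / eps).
have l0 : 0 < l.
  by rewrite lt_min tau0 divr_gt0 // ln_gt0 // ltrDl.
exists (rho * (expR l - 1)).
  by rewrite mulr_gt0 // subr_gt0 expR_gt1.
move=> s s' rs sD ss' s's.
have s0 : 0 < s by exact: lt_le_trans rs.
have s'0 : 0 < s' by exact: lt_le_trans ss'.
have s'l : s' <= s * expR l.
  apply: (le_trans s's); rewrite -lerBrDl.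
  have -> : s * expR l - s = s * (expR l - 1) by ring.
  by rewrite ler_wpM2r // subr_ge0 ltW // expR_gt1.
have hln : ln s' <= ln s + l.
  by rewrite -[l in leRHS]expRK -lnM ?posrE ?expR_gt0 // ler_ln ?posrE ?mulr_gt0 ?expR_gt0.
have hpow : s' `^ eps <= s `^ eps * (1 + tau).
  apply: (@le_trans _ _ ((s * expR l) `^ eps)).
    by apply: ge0_ler_powR; rewrite ?nnegrE ?mulr_ge0 ?expR_ge0 // ltW.
  rewrite powRM ?expR_ge0 ?(ltW s0) // ler_wpM2l ?powR_ge0 //.
  rewrite -expRM -ler_ln ?posrE ?expR_gt0 ?addr_gt0 // expRK.
  by rewrite -ler_pdivlMr // ge_min lexx orbT.
have ltau : l <= tau by rewrite ge_min lexx.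
have hD : s `^ eps <= D `^ eps.
  by apply: ge0_ler_powR => //; rewrite ?nnegrE ?ltW // (lt_le_trans s0).
rewrite /profile -{1}(lnK (x := sigma)) ?posrE ?(lt_trans _ sg1) // -expRD ler_expR.
have e : tau * P = ln sigma by rewrite /tau divfK // gt_eqF.
rewrite -e /P.
have h1 : gam * ln s' <= gam * (ln s + tau) by rewrite ler_wpM2l //; lra.
have h2 : A * s' `^ eps <= A * (s `^ eps * (1 + tau)) by rewrite ler_wpM2l.
have h3 : A * tau * s `^ eps <= A * tau * D `^ eps by rewrite ler_wpM2l // mulr_ge0 // ltW.
nra.
Qed.

(** Truncation at [rho] does not increase distances, so the estimate for the profile carries over;
    if the truncated [t'] is the smaller argument, monotonicity and [sigma > 1] suffice. *)
Lemma kernel_slowly_varying (R : realType) (gam A eps rho D sigma : R) :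
  0 <= gam -> 0 <= A -> 0 < eps -> 0 < rho <= D -> 1 < sigma ->
  exists2 delta : R, 0 < delta & forall t t', t <= D ->
    `|t - t'| <= delta ->
    kernel R gam A eps rho t <= sigma * kernel R gam A eps rho t'.
Proof.
move=> g0 A0 e0 /andP[r0 rD] sg1.
have [delta d0 h] := profile_slowly_varying R gam A eps rho D sigma g0 A0 e0 r0 sg1.
exists delta => // t t' tD tt'; rewrite /kernel.
have m0 : rho <= Num.max t rho by rewrite le_max lexx orbT.
have [le|/ltW le] := leP (Num.max t rho) (Num.max t' rho).
  apply: h => //; first by rewrite ge_max tD.
  rewrite ge_max; apply/andP; split.
    rewrite (@le_trans _ _ (t + delta)) ?lerD2r ?le_max ?lexx //.
    by move: tt'; rewrite ler_norml; lra.
  by rewrite (le_trans m0) // lerDl ltW.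
apply: (@le_trans _ _ (profile R gam A eps (Num.max t' rho))).
  by apply: profile_nincr => //; rewrite ?ltW // (lt_le_trans r0) // le_max lexx orbT.
by rewrite ler_peMl ?expR_ge0 // ltW.
Qed.

Lemma measurable_kernel (R : realType) (gam A eps rho : R) :
  measurable_fun [set: R] (kernel R gam A eps rho).
Proof.
apply: measurableT_comp => //; last exact: measurable_maxr.
rewrite /profile.
apply: measurableT_comp => //; apply: measurableT_comp => //.
apply: measurable_funD; apply: measurable_funM => //.
Qed.

(** * Integration against the stationary measure *)

Lemma ifs_map_derivable (R : realType) (T : ifscheme R) (j : 'I_(ifs_size T)) (x : R) :
  derivable (ifs_map j) x 1.
Proof. by have [_ _ [] ] := ifs_diffeo j. Qed.

Lemma measurable_ifs_map (R : realType) (T : ifscheme R) (j : 'I_(ifs_size T)) :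
  measurable_fun [set: measurableTypeR R]
    (ifs_map j : measurableTypeR R -> measurableTypeR R).
Proof.
apply: (@continuous_measurable_fun R (ifs_map j)) => x.
by apply/differentiable_continuous/derivable1_diffP; exact: ifs_map_derivable.
Qed.

(** Stationarity presents [mu] as a finite weighted sum of pushforwards; each summand is then
    treated by a change of variables. *)
Lemma stationary_integral (R : realType) (T : ifscheme R)
    (mu : probability (measurableTypeR R) R) (I : set (measurableTypeR R))
    (F : measurableTypeR R -> \bar R) :
  stationary T mu -> measurable I -> measurable_fun [set: measurableTypeR R] F ->
  (forall y, 0 <= F y)%E ->
  (\int[mu]_(y in I) F y = \sum_(j < ifs_size T)
     (ifs_prob j)%:E * \int[mu]_(y in ifs_map j @^-1` I) F (ifs_map j y))%E.
Proof.
move=> hmu mI mF F0.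
have mFI : measurable_fun I F by apply: measurable_funS mF.
pose P (j : 'I_(ifs_size T)) : {nonneg R} := NngNum (ifs_prob_ge0 j).
pose nu (j : 'I_(ifs_size T)) : measure (measurableTypeR R) R :=
  measure_function_pushforward__canonical__measure_function_Measure mu
    (measurable_ifs_map R T j).
(* [msum] is indexed by natural numbers, so indices outside the scheme receive the zero measure. *)
pose m_ (k : nat) : measure (measurableTypeR R) R :=
  if insub k is Some j then mscale (P j) (nu j) else mzero.
rewrite (eq_measure_integral (msum m_ (ifs_size T))).
  rewrite ge0_integral_measure_sum //.
  apply: eq_bigr => j _; rewrite /m_ valK.
  rewrite ge0_integral_mscale //; congr (_ * _)%E.
  by rewrite /nu ge0_integral_pushforward //; exact: measurable_ifs_map.
move=> A mA _; apply: (etrans (hmu A mA)); rewrite /msum; apply: eq_bigr => j _.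
by rewrite /m_ valK.
Qed.

(** * Potentials and the action of the diffusion operator on them *)

(** [fine] would send an infinite integral to 0; for the bounded measurable kernels considered here
    the integral is finite and nothing is lost. *)
Definition potential (R : realType) (mu : probability (measurableTypeR R) R)
    (A B : R) (k : R -> R) (x : R) : R :=
  fine (\int[mu]_(y in `[A, B]) (k `|x - y|)%:E)%E.

Lemma measurable_dist_comp (R : realType) (k : R -> R) (x : R) :
  measurable_fun [set: R] k ->
  measurable_fun [set: measurableTypeR R]
    ((fun y => (k `|x - y|)%:E) : measurableTypeR R -> \bar R).
Proof.
move=> mk; apply/measurable_EFinP.
have h : measurable_fun [set: R] (fun y : R => `|x - y|).
  by apply: measurableT_comp => //; exact: measurable_funB.
exact: (measurableT_comp mk h).
Qed.

Lemma potential_EFin (R : realType) (mu : probability (measurableTypeR R) R)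
    (A B M : R) (k : R -> R) (x : R) :
  measurable_fun [set: R] k -> (forall t, 0 <= k t <= M) ->
  [/\ ((potential R mu A B k x)%:E = \int[mu]_(y in `[A, B]) (k `|x - y|)%:E)%E,
   0 <= potential R mu A B k x & potential R mu A B k x <= M].
Proof.
move=> mk kM.
have mI : measurable (`[A, B]%classic : set (measurableTypeR R)) by exact: measurable_itv.
have M0 : 0 <= M by have /andP[h /(le_trans h)] := kM 0.
have i0 : (0 <= \int[mu]_(y in `[A, B]) (k `|x - y|)%:E)%E.
  by apply: integral_ge0 => y _; rewrite lee_fin; have /andP[] := kM `|x - y|.
have iM : (\int[mu]_(y in `[A, B]) (k `|x - y|)%:E <= M%:E)%E.
  apply: (@le_trans _ _ (\int[mu]_(y in `[A, B]) (cst M%:E y))%E).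
    apply: ge0_le_integral => //.
    - by move=> y _; rewrite lee_fin; have /andP[] := kM `|x - y|.
    - by apply: measurable_funS (measurable_dist_comp R k x mk).
    - by move=> y _; rewrite lee_fin; have /andP[] := kM `|x - y|.
  rewrite integral_cst // -[leRHS]mule1 lee_wpmul2l ?lee_fin //.
  exact: probability_le1.
have e : ((potential R mu A B k x)%:E = \int[mu]_(y in `[A, B]) (k `|x - y|)%:E)%E.
  rewrite /potential fineK // ge0_fin_numE //.
  by apply: (le_lt_trans iM); rewrite ltry.
by split=> //; rewrite -lee_fin e.
Qed.

Lemma potential_ge (R : realType) (mu : probability (measurableTypeR R) R)
    (A B m M : R) (k : R -> R) (x : R) :
  measurable_fun [set: R] k -> (forall t, 0 <= k t <= M) -> 0 <= m ->
  A <= x <= B -> (forall t, 0 <= t <= B - A -> m <= k t) ->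
  m * fine (mu `[A, B]%classic) <= potential R mu A B k x.
Proof.
move=> mk kM m0 xI hm.
have mI : measurable (`[A, B]%classic : set (measurableTypeR R)) by exact: measurable_itv.
have [e _ _] := potential_EFin R mu A B M k x mk kM.
rewrite -lee_fin e EFinM fineK; last first.
  by rewrite ge0_fin_numE // (le_lt_trans (probability_le1 _ mI)) // ltry.
rewrite -integral_cst //.
apply: ge0_le_integral => //.
- by apply: measurable_funS (measurable_dist_comp R k x mk).
- move=> y /=; rewrite in_itv /= lee_fin => yI; apply: hm.
  by rewrite normr_ge0 ler_norml; lra.
Qed.

Lemma potential_slowly_varying (R : realType)
    (mu : probability (measurableTypeR R) R)
    (A B M delta sigma : R) (k : R -> R) (x x' : R) :
  measurable_fun [set: R] k -> (forall t, 0 <= k t <= M) -> 0 <= sigma ->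
  (forall t t', t <= B - A -> `|t - t'| <= delta -> k t <= sigma * k t') ->
  A <= x <= B -> `|x - x'| <= delta ->
  potential R mu A B k x <= sigma * potential R mu A B k x'.
Proof.
move=> mk kM sg0 hk xI xx'.
have mI : measurable (`[A, B]%classic : set (measurableTypeR R)) by exact: measurable_itv.
have [e _ _] := potential_EFin R mu A B M k x mk kM.
have [e' _ _] := potential_EFin R mu A B M k x' mk kM.
have k0 t : 0 <= k t by have /andP[] := kM t.
rewrite -lee_fin EFinM e e' -ge0_integralZl ?lee_fin //; last 2 first.
- by apply: measurable_funS (measurable_dist_comp R k x' mk).
- by move=> y _; rewrite lee_fin.
apply: ge0_le_integral => //.
- by move=> y _; rewrite lee_fin.
- by apply: measurable_funS (measurable_dist_comp R k x mk).
- apply: measurable_funeM.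
  by apply: measurable_funS (measurable_dist_comp R k x' mk).
- move=> y /=; rewrite in_itv /= => yI; rewrite -EFinM lee_fin; apply: hk.
    by rewrite ler_norml; lra.
  apply: le_trans xx'; apply: (le_trans (ler_dist_dist _ _)).
  by rewrite (_ : x - y - (x' - y) = x - x') //; ring.
Qed.

(** The pointwise kernel inequality is integrated over [y]; the indicator contributes at most the
    mass of the ball. Extended reals are kept so that the result can be summed directly with
    stationarity. *)
Lemma potential_pullback (R : realType) (T : ifscheme R) (j : 'I_(ifs_size T))
    (mu : probability (measurableTypeR R) R)
    (A B M lam E0 R0 c a z : R) (k : R -> R) :
  measurable_fun [set: R] k -> (forall t, 0 <= k t <= M) ->
  0 <= lam -> 0 <= E0 -> 0 <= a -> (mu (ball z R0) <= c%:E)%E ->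
  (forall y, A <= y <= B -> a * k `|z - y| <=
     lam * k `|ifs_map j z - ifs_map j y| + E0 * \1_(ball z R0) y) ->
  ((a * potential R mu A B k z)%:E <=
   lam%:E * \int[mu]_(y in `[A, B]) (k `|ifs_map j z - ifs_map j y|)%:E
     + (E0 * c)%:E)%E.
Proof.
move=> mk kM lam0 E00 a0 hc hk.
have mI : measurable (`[A, B]%classic : set (measurableTypeR R)) by exact: measurable_itv.
have mb : measurable (ball z R0 : set (measurableTypeR R)) by exact: measurable_ball.
have [e _ _] := potential_EFin R mu A B M k z mk kM.
have k0 t : 0 <= k t by have /andP[] := kM t.
have mk1 : measurable_fun [set: measurableTypeR R]
    ((fun y => (k `|ifs_map j z - ifs_map j y|)%:E) : measurableTypeR R -> \bar R).
  exact: (measurableT_comp (measurable_dist_comp R k (ifs_map j z) mk) (measurable_ifs_map R T j)).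
have mI1 : measurable_fun [set: measurableTypeR R]
    ((fun y => (\1_(ball z R0) y)%:E) : measurableTypeR R -> \bar R).
  by apply/measurable_EFinP; exact: measurable_indic.
rewrite EFinM e -ge0_integralZl ?lee_fin //; last 2 first.
- by apply: measurable_funS (measurable_dist_comp R k z mk).
- by move=> y _; rewrite lee_fin.
apply: (@le_trans _ _ (\int[mu]_(y in `[A, B])
   (lam%:E * (k `|ifs_map j z - ifs_map j y|)%:E + E0%:E * (\1_(ball z R0) y)%:E))%E).
  apply: ge0_le_integral => //.
  - by move=> y _; rewrite -EFinM lee_fin mulr_ge0.
  - apply: measurable_funeM.
    by apply: measurable_funS (measurable_dist_comp R k z mk).
  - apply: measurable_funS (emeasurable_funD (measurable_funeM _ mk1) (measurable_funeM _ mI1)) => //.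
rewrite ge0_integralD //; last 4 first.
- by move=> y _; rewrite -EFinM lee_fin mulr_ge0.
- by apply: measurable_funS (measurable_funeM _ mk1).
- by move=> y _; rewrite -EFinM lee_fin mulr_ge0.
- by apply: measurable_funS (measurable_funeM _ mI1).
rewrite ge0_integralZl ?lee_fin //; last 2 first.
- by apply: measurable_funS mk1.
- by move=> y _; rewrite lee_fin.
rewrite ge0_integralZl ?lee_fin //; last first.
- by apply: measurable_funS mI1.
rewrite leeD2l // EFinM lee_wpmul2l ?lee_fin // integral_indic //.
apply: le_trans hc; apply: le_measure; rewrite ?inE //.
exact: measurableI.
Qed.

(** In the [j]-th term put [z = ifs_inv j x], so that the pulled-back integrand is
    [k |x - ifs_map j y|]. Stationarity recombines these integrals into the potential at [x], and
    the error is counted once because the weights sum to 1. *)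
Lemma diffusion_potential_le (R : realType) (T : ifscheme R)
    (mu : probability (measurableTypeR R) R)
    (A B M lam E0 R0 c alpha x : R) (k : R -> R) :
  stationary T mu ->
  (forall (j : 'I_(ifs_size T)) y, A <= y <= B -> A <= ifs_map j y <= B) ->
  measurable_fun [set: R] k -> (forall t, 0 <= k t <= M) ->
  0 <= lam -> 0 <= E0 -> (forall z, mu (ball z R0) <= c%:E)%E ->
  (forall (j : 'I_(ifs_size T)) z y, A <= z <= B -> A <= y <= B ->
     `|derive1 (ifs_inv j) (ifs_map j z)| `^ alpha * k `|z - y| <=
     lam * k `|ifs_map j z - ifs_map j y| + E0 * \1_(ball z R0) y) ->
  diffusion alpha T (fun z => if A <= z <= B then potential R mu A B k z else 0) x
    <= lam * potential R mu A B k x + E0 * c.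
Proof.
move=> hmu hI mk kM lam0 E00 hc hk.
have mI : measurable (`[A, B]%classic : set (measurableTypeR R)) by exact: measurable_itv.
have [e _ _] := potential_EFin R mu A B M k x mk kM.
have k0 t : 0 <= k t by have /andP[] := kM t.
have c0 : 0 <= c by rewrite -lee_fin; apply: le_trans (hc 0).
have mkx := measurable_dist_comp R k x mk.
have mkxj (j : 'I_(ifs_size T)) : measurable_fun [set: measurableTypeR R]
    ((fun y => (k `|x - ifs_map j y|)%:E) : measurableTypeR R -> \bar R).
  exact: (measurableT_comp mkx (measurable_ifs_map R T j)).
have i0 (j : 'I_(ifs_size T)) : (0 <= \int[mu]_(y in `[A, B]) (k `|x - ifs_map j y|)%:E)%E.
  by apply: integral_ge0 => y _; rewrite lee_fin.
(* This is only an inequality: by invariance [[A, B]] lies in its preimage under each map, and the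
   preimage may be larger. *)
have hS : (\sum_(j < ifs_size T)
    (ifs_prob j)%:E * \int[mu]_(y in `[A, B]) (k `|x - ifs_map j y|)%:E
    <= (potential R mu A B k x)%:E)%E.
  rewrite e (stationary_integral R T mu _ _ hmu mI mkx); last first.
    by move=> y; rewrite lee_fin.
  apply: lee_sum => j _; rewrite lee_wpmul2l ?lee_fin ?ifs_prob_ge0 //.
  apply: ge0_subset_integral => //.
  - rewrite -[_ @^-1` _]setTI; exact: measurable_ifs_map.
  - by apply: measurable_funS (mkxj j).
  - by move=> y _; rewrite lee_fin.
  - by move=> y /=; rewrite !in_itv /=; exact: hI.
rewrite -lee_fin EFinD.
apply: (@le_trans _ _ (\sum_(j < ifs_size T)
    ((lam%:E * ((ifs_prob j)%:E * \int[mu]_(y in `[A, B]) (k `|x - ifs_map j y|)%:E))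
     + (ifs_prob j * (E0 * c))%:E))%E).
  rewrite /diffusion -sumEFin; apply: lee_sum => j _.
  have [_ gK _ _] := ifs_diffeo j.
  (* A branch whose preimage of [x] leaves [[A, B]] contributes 0. *)
  case: ifPn => zI; last first.
    rewrite mulr0 adde_ge0 //.
      by rewrite mule_ge0 ?lee_fin // mule_ge0 ?lee_fin ?ifs_prob_ge0.
    by rewrite lee_fin !mulr_ge0 // ifs_prob_ge0.
  have := @potential_pullback R T j mu A B M lam E0 R0 c
    (`|derive1 (ifs_inv j) x| `^ alpha) (ifs_inv j x) k mk kM lam0 E00
    (powR_ge0 _ _) (hc _).
  rewrite gK => H; rewrite -mulrA !EFinM [in leRHS]muleCA -muleDr //; last first.
    by apply: ge0_adde_def; rewrite inE ?mule_ge0 ?lee_fin ?mulr_ge0.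
  rewrite lee_wpmul2l ?lee_fin ?ifs_prob_ge0 //.
  rewrite -!EFinM; apply: H => y yI.
  by have := hk j (ifs_inv j x) y zI yI; rewrite gK.
rewrite big_split /= -ge0_sume_distrr; last first.
  by move=> j _; rewrite mule_ge0 // lee_fin ifs_prob_ge0.
rewrite sumEFin -mulr_suml ifs_prob_sum1 mul1r leeD2r // EFinM.
by rewrite lee_wpmul2l ?lee_fin.
Qed.

(** * Step functions on a grid *)

(* Only the nonempty fibres of [q] may serve as cells, since the cells of a
   [partition] must be nonempty. *)
Lemma piecewise_constant_nondecreasing (R : realType) (psi : R -> R)
    (q : R -> nat) (N : nat) :
  {homo q : x y / x <= y >-> (x <= y)%N} -> (forall x, q x < N)%N ->
  (forall x y, q x = q y -> psi x = psi y) ->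
  piecewise_constant_on [set: R] psi.
Proof.
move=> hq qN hpsi.
pose S : {pred 'I_N} := [pred i : 'I_N | `[< exists x, q x = i >]].
exists #|S|, (fun i : 'I_#|S| => [set x | q x = (enum_val i : 'I_N)]); split.
- split.
  + apply/seteqP; split=> // x _.
    have xS : Ordinal (qN x) \in S by rewrite inE; exists x.
    by exists (enum_rank_in xS (Ordinal (qN x))) => //=; rewrite (enum_rankK_in xS xS).
  + apply/trivIsetP => i j _ _ ij; apply/seteqP; split=> // x [/= e1 e2].
    by move: ij; rewrite (enum_val_inj (ord_inj (etrans (esym e1) e2))) eqxx.
  + move=> i _; have := enum_valP i; rewrite inE => -[x xi].
    by exists x.
- move=> i x y /= qx qy z /andP[xz zy]; apply/eqP; rewrite eqn_leq.
  by rewrite -{1}qy -qx !hq.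
- by move=> i x y /= qx qy; apply: hpsi; rewrite qx qy.
Qed.

Lemma piecewise_constant_grid (R : realType) (A B delta : R) (psi : R -> R) :
  0 < delta ->
  piecewise_constant_on [set: R] (fun x => if A <= x <= B
     then psi (A + delta * (Num.truncn ((x - A) / delta))%:R) else 0).
Proof.
move=> d0.
pose t x := Num.truncn ((x - A) / delta).
have tle x y : x <= y -> (t x <= t y)%N.
  move=> xy; apply: le_truncn; rewrite ler_wpM2r ?invr_ge0 ?lerD2r //; exact: ltW.
(* The function vanishes on both outer parts, but they get different labels, below and above those
   of the cells, to keep [q] nondecreasing. *)
pose q x := if x < A then 0%N else if x <= B then (t x).+1 else (t B).+2.
apply: (@piecewise_constant_nondecreasing R _ q (t B).+3).
- move=> x y xy; rewrite /q.
  case: (ltP x A) => // Ax; rewrite ltNge (le_trans Ax xy) /=.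
  case: (leP y B) => yB; first by rewrite (le_trans xy yB) ltnS tle.
  by case: (leP x B) => // xB; rewrite ltnS (leq_trans (tle _ _ xB)).
- move=> x; rewrite /q; case: ifP => // _; case: ifP => // xB.
  by rewrite !ltnS (leq_trans (tle _ _ xB)).
- move=> x y; rewrite /q -/(t x) -/(t y).
  case: (ltP x A) => xA; case: (ltP y A) => yA //=;
  case: (leP x B) => xB; case: (leP y B) => yB //=.
  + by move=> [->].
  + by move=> [e]; have := tle _ _ xB; rewrite e ltnn.
  + by move=> [e]; have := tle _ _ yB; rewrite -e ltnn.
Qed.

Lemma grid_point (R : realType) (A B delta x : R) :
  0 < delta -> A <= x <= B ->
  A <= A + delta * (Num.truncn ((x - A) / delta))%:R <= B /\
  `|x - (A + delta * (Num.truncn ((x - A) / delta))%:R)| <= delta.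
Proof.
move=> d0 xI.
have h0 : 0 <= (x - A) / delta by rewrite divr_ge0 ?(ltW d0) // subr_ge0; have /andP[] := xI.
have := truncn_itv h0.
rewrite -natr1; set n : R := (Num.truncn _)%:R.
rewrite ler_pdivlMr // ltr_pdivrMr // mulrDl mul1r [n * _]mulrC => /andP[h1 h2].
have n0 : 0 <= delta * n by rewrite mulr_ge0 // ltW.
move: (delta * n) h1 h2 n0 => v h1 h2 n0.
by split; [|rewrite ler_norml]; lra.
Qed.

(** * The kernel inequality along the maps of a scheme *)

Lemma kernel_bounds (R : realType) (gam A eps rho t : R) :
  0 <= gam -> 0 <= A -> 0 <= eps -> 0 < rho ->
  0 <= kernel R gam A eps rho t <= rho `^ (- gam).
Proof.
move=> g0 A0 e0 r0; rewrite expR_ge0 /=.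
apply: le_trans (profile_le_powR R gam A eps rho A0 r0).
by apply: profile_nincr => //; rewrite le_max lexx orbT.
Qed.

(** For [t >= rho] neither truncation is active and the profiles contract. For [t < rho] the bound
    [u <= G * t] switches the indicator on, and the error term alone dominates through [a <= G] and
    the supremum bound of the kernel. *)
Lemma kernel_contract (R : realType) (gam A eps alpha theta L G rho a t u : R) :
  0 < eps -> 0 < theta < 1 -> 0 <= alpha < gam -> 0 <= A ->
  gam * L <= A * (1 - theta `^ eps) -> 0 < rho -> 0 < G -> 0 <= u ->
  t <= theta * u -> 1 <= theta * a -> a <= G -> u <= G * t ->
  a * t <= u * expR (L * u `^ eps) ->
  a `^ alpha * kernel R gam A eps rho u <=
    theta `^ (gam - alpha) * kernel R gam A eps rho t
    + G `^ alpha * rho `^ (- gam) * (u < G * rho)%R%:R.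
Proof.
move=> e0 /andP[th0 th1] alg A0 hA r0 G0 u0 tu tha aG uG hat.
have gam0 : 0 <= gam by have /andP[al0 /ltW] := alg; exact: le_trans.
have /andP[al0 _] := alg.
have [rt|tr] := leP rho t.
  have t0 : 0 < t by exact: lt_le_trans rt.
  have ut : t <= u by apply: (le_trans tu); rewrite ler_piMl // ltW.
  apply: (@le_trans _ _ (theta `^ (gam - alpha) * kernel R gam A eps rho t)).
    rewrite /kernel (max_l rt) (max_l (le_trans rt ut)).
    exact: (profile_contract R gam A eps alpha theta L a t u).
  by rewrite lerDl !mulr_ge0 ?powR_ge0.
have -> : u < G * rho by apply: (le_lt_trans uG); rewrite ltr_pM2l.
rewrite mulr1 (@le_trans _ _ (G `^ alpha * rho `^ (- gam))) //; last first.
  by rewrite lerDr mulr_ge0 ?powR_ge0 ?expR_ge0.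
have /andP[k0 kr] := kernel_bounds R gam A eps rho u gam0 A0 (ltW e0) r0.
have a0 : 0 <= a by rewrite -(pmulr_rge0 _ th0); exact: le_trans tha.
by apply: ler_pM; rewrite ?powR_ge0 // ge0_ler_powR // nnegrE // ltW.
Qed.

(** The constants are uniform over the maps and independent of [rho], which can therefore be chosen
    after them. *)
Lemma ifs_kernel_contract (R : realType) (T : ifscheme R) (A B alpha gam : R) :
  A <= B -> 0 <= alpha < gam ->
  exists K eps theta G : R,
    [/\ 0 <= K, 0 < eps, 0 < theta < 1, 0 < G &
     forall rho, 0 < rho -> forall (j : 'I_(ifs_size T)) z y,
       A <= z <= B -> A <= y <= B ->
       `|derive1 (ifs_inv j) (ifs_map j z)| `^ alpha * kernel R gam K eps rho `|z - y| <=
       theta `^ (gam - alpha) * kernel R gam K eps rho `|ifs_map j z - ifs_map j y|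
       + G `^ alpha * rho `^ (- gam) * \1_(ball z (G * rho)) y].
Proof.
move=> AB alg.
have [eps e0 heps] := ifs_hoelder T.
have [th0 th01 hth0] := ifs_contracting T.
(* The maximum makes the rate positive, so that its logarithm and powers behave. *)
pose theta := Num.max th0 2^-1.
have hth (j : 'I_(ifs_size T)) x : `|derive1 (ifs_map j) x| <= theta.
  by rewrite le_max hth0.
have th_gt0 : 0 < theta by rewrite lt_max invr_gt0 ltr0n orbT.
have th_lt1 : theta < 1 by rewrite gt_max th01 /=; lra.
have := fun j => C1_diffeo_distortion R _ _ A B eps theta
  (ifs_diffeo j) (heps j) e0 (hth j) AB.
move=> /fin_all_exists[L /fin_all_exists[G hLG]].
(* Sums of absolute values dominate the constants of all maps at once. *)
have sum_ge (F : 'I_(ifs_size T) -> R) j : F j <= \sum_i `|F i|.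
  by rewrite (bigD1 j) //= (le_trans (ler_norm _)) // lerDl sumr_ge0.
pose L' : R := \sum_i `|L i|; pose G' : R := \sum_i `|G i| + 1.
have L'0 : 0 <= L' by exact: sumr_ge0.
have G'0 : 0 < G' by rewrite ltr_wpDl // sumr_ge0.
have the1 : theta `^ eps < 1.
  by rewrite -[ltRHS](congr1 (@^~ eps) (powR1 R)) gt0_ltr_powR // nnegrE // ltW.
have gam0 : 0 < gam by have /andP[al0] := alg; exact: le_lt_trans.
(* With this damping constant the condition that the damping absorbs the distortion holds with
   equality. *)
exists (gam * L' / (1 - theta `^ eps)), eps, theta, G'.
have K0 : 0 <= gam * L' / (1 - theta `^ eps).
  by rewrite divr_ge0 ?mulr_ge0 ?subr_ge0 // ltW.
split=> //; first by rewrite th_gt0.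
move=> rho r0 j z y zI yI.
have [||h1 h2 h3 h4 h5] := hLG j L' G' _ _ z y zI yI.
- exact: sum_ge.
- by rewrite (le_trans (sum_ge G j)) // lerDl.
have -> : \1_(ball z (G' * rho)) y = (`|z - y| < G' * rho)%R%:R :> R.
  rewrite indicE; congr (_ %:R); congr nat_of_bool.
  by apply/idP/idP; rewrite inE.
apply: (kernel_contract R gam _ eps alpha theta L') => //.
- by rewrite th_gt0.
- by rewrite divfK // gt_eqF // subr_gt0.
Qed.

(** * An invariant neighbourhood of positive mass *)

Lemma closed_neighbourhood_itv (R : realType) (a b r x : R) :
  a <= b -> 0 <= r ->
  closed_neighbourhood r `[a, b] x <-> a - r <= x <= b + r.
Proof.
move=> ab r0; split=> [[y /=]|xI].
  by rewrite in_itv /= ler_norml; lra.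
have [xa|ax] := leP x a.
  by exists a; rewrite /= ?in_itv /= ?ler_norml; lra.
have [bx|xb] := leP b x.
  by exists b; rewrite /= ?in_itv /= ?ler_norml; lra.
by exists x; rewrite /= ?in_itv /= ?ler_norml; lra.
Qed.

(** The neighbourhoods of radius [n + 1] exhaust the line, so they cannot all be null sets. *)
Lemma probability_itv_gt0 (R : realType)
    (mu : probability (measurableTypeR R) R) (a b : R) :
  exists2 r : R, 0 < r & (0 < mu `[(a - r)%R, (b + r)%R]%classic)%E.
Proof.
apply: contrapT => /forall2NP H.
pose F (n : nat) : set (measurableTypeR R) := `[(a - n.+1%:R), (b + n.+1%:R)]%classic.
have F0 n : mu (F n) = 0%E.
  have [/negP|/negP] := H n.+1%:R; first by rewrite ltr0n.
  by rewrite -leNgt => h; apply/eqP; rewrite eq_le h measure_ge0.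
have mF n : measurable (F n) by exact: measurable_itv.
have FT : \bigcup_n F n = setT.
  apply/seteqP; split=> // x _.
  exists (Num.truncn (`|x - a| + `|x - b|)) => //; rewrite /F /= in_itv /=.
  have := truncnS_gt (`|x - a| + `|x - b|).
  set n := _.+1%:R => hn.
  have := ler_norm (x - b); have := ler_norm (- (x - a)); rewrite normrN.
  have := normr_ge0 (x - a); have := normr_ge0 (x - b); lra.
have : mu (\bigcup_n F n) = 0%E.
  apply: measure_negligible; first exact: bigcupT_measurable.
  by apply: negligible_bigcup => n; exists (F n); split; [exact: mF|exact: F0|].
by rewrite FT probability_setT => /eqP; rewrite onee_eq0.
Qed.

Lemma ifs_map_nonexpanding (R : realType) (T : ifscheme R)
    (j : 'I_(ifs_size T)) (x y : R) :
  `|ifs_map j x - ifs_map j y| <= `|x - y|.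
Proof.
have [th th1 hth] := ifs_contracting T.
have [||xi [_ _ _ ->]] := derivable_mean_value R (ifs_map j) (Num.min x y) (Num.max x y) x y
  (ifs_map_derivable R T j).
- by rewrite ge_min le_max lexx.
- by rewrite ge_min le_max lexx !orbT.
by rewrite ler_piMl // (le_trans (hth j xi)) // ltW.
Qed.

(** Each map preserves the interval and does not expand distances, so the enlarged interval is
    invariant as well. *)
Lemma ifs_map_closed_neighbourhood (R : realType) (T : ifscheme R)
    (j : 'I_(ifs_size T)) (r x : R) :
  closed_neighbourhood r (ifs_interval T) x ->
  closed_neighbourhood r (ifs_interval T) (ifs_map j x).
Proof.
case=> y yJ xy; exists (ifs_map j y).
  by apply: (@ifs_invariant _ T j); exists y.
exact: le_trans (ifs_map_nonexpanding R T j x y) xy.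
Qed.

Lemma exists_powR_le (R : realType) (p d D : R) :
  0 < p -> 0 < d -> 0 < D -> exists2 rho, 0 < rho <= D & rho `^ p <= d.
Proof.
move=> p0 d0 D0; exists (Num.min D (d `^ p^-1)).
  by rewrite lt_min D0 powR_gt0 //= ge_min lexx.
apply: (@le_trans _ _ ((d `^ p^-1) `^ p)); last first.
  by rewrite -powRrM mulVf ?gt_eqF // powRr1 // ltW.
apply: ge0_ler_powR; rewrite ?nnegrE ?powR_ge0 ?ge_min ?lexx ?orbT ?ltW //.
by rewrite lt_min D0 powR_gt0.
Qed.

(** * From a supersolution to a strict step supersolution *)

Lemma diffusion_homo (R : realType) (T : ifscheme R) (alpha s x : R)
    (phi psi : R -> R) :
  (forall z, phi z <= s * psi z) ->
  diffusion alpha T phi x <= s * diffusion alpha T psi x.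
Proof.
move=> h; rewrite /diffusion mulr_sumr; apply: ler_sum => j _.
by rewrite mulrCA ler_wpM2l // mulr_ge0 ?powR_ge0 ?ifs_prob_ge0.
Qed.

Lemma slack_lt1 (R : realType) (l : R) :
  0 < l < 1 -> (1 + (1 - l) / 4) * l * (1 + (1 - l) / 4) < 1.
Proof.
move=> /andP[l0 l1]; set e := (1 - l) / 4.
(* In terms of [e] the gap is [1 - (1 + e)^2 (1 - 4 e) = e (2 + 7 e + 4 e^2)]. *)
have -> : l = 1 - 4 * e by rewrite /e; field.
have e0 : 0 < e by rewrite /e; lra.
move: (e) e0 => {}e e0; rewrite -subr_gt0 [ltRHS](_ : _ = e * (2 + 7 * e + 4 * e ^+ 2)); last by ring.
by rewrite mulr_gt0 // addr_gt0 ?mulr_gt0 ?exprn_gt0 // addr_gt0 ?mulr_gt0.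
Qed.

(* If [D u <= l u] and [u] varies at most by the factor [s] over a cell of the
   grid, then [D v <= s D u <= s l u <= s^2 l v < v] for the step function [v]
   sampling [u] on the grid, where [s = 1 + (1 - l) / 4] gives [s^2 l < 1]. *)
Lemma step_strict_supersolution (R : realType) (T : ifscheme R)
    (A B alpha l delta m M : R) (u : R -> R) :
  0 < l < 1 -> 0 < delta -> 0 < m -> (forall x, 0 <= u x <= M) ->
  (forall x, A <= x <= B -> m <= u x) ->
  (forall x x', A <= x <= B -> `|x - x'| <= delta ->
     u x <= (1 + (1 - l) / 4) * u x') ->
  (forall x, A <= x <= B ->
     diffusion alpha T (fun z => if A <= z <= B then u z else 0) x <= l * u x) ->
  exists v : R -> R,
    [/\ forall x, 0 <= v x, piecewise_constant_on setT v,
        forall x, ~ (A <= x <= B) -> v x = 0,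
        forall x, A <= x <= B -> m <= v x <= M &
        forall x, A <= x <= B -> diffusion alpha T v x < v x].
Proof.
move=> l01 d0 m0 uM um uslow udiff; have /andP[l0 l1] := l01.
have slack := slack_lt1 R l l01; move: slack uslow.
have : 0 <= 1 + (1 - l) / 4 by lra.
move: (1 + (1 - l) / 4) => s s0 slack uslow.
pose grid x := A + delta * (Num.truncn ((x - A) / delta))%:R.
exists (fun x => if A <= x <= B then u (grid x) else 0); split.
- by move=> x; case: ifP => // _; have /andP[] := uM (grid x).
- exact: piecewise_constant_grid.
- by move=> x /negP /negPf ->.
- move=> x xI; rewrite xI.
  have [gI _] := grid_point R A B delta x d0 xI.
  by rewrite um //=; have /andP[] := uM (grid x).
- move=> x xI; rewrite xI.
  have [gI gx] := grid_point R A B delta x d0 xI.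
  have h1 : diffusion alpha T (fun z => if A <= z <= B then u (grid z) else 0) x
      <= s * (l * u x).
    apply: le_trans (ler_wpM2l s0 (udiff x xI)).
    apply: diffusion_homo => z.
    have [zI|_] := boolP (A <= z <= B); last by rewrite mulr0.
    have [gzI gz] := grid_point R A B delta z d0 zI.
    by apply: (uslow _ _ gzI); rewrite distrC.
  apply: (le_lt_trans h1).
  apply: (@le_lt_trans _ _ (s * (l * (s * u (grid x))))).
    by rewrite ler_wpM2l // ler_wpM2l ?(ltW l0) // uslow.
  by rewrite !mulrA gtr_pMl //; apply: lt_le_trans (um _ gI).
Qed.

(** * Choice of the parameters and assembly of the estimates *)

Theorem theorem1p25 (R : realType) (T : ifscheme R)
    (mu : probability (measurableTypeR R) R) (hmu : stationary T mu)
    (alpha : R) (halpha0 : 0 < alpha)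
    (halpha : (alpha%:E < frostman_dim mu)%E) :
  exists r : R, 0 < r /\
  exists psi : R -> R,
    [/\ forall x : R, 0 <= psi x,
        piecewise_constant_on setT psi,
        forall x : R, ~ closed_neighbourhood r (ifs_interval T) x -> psi x = 0,
        exists m M : R, 0 < m /\
          forall x : R, closed_neighbourhood r (ifs_interval T) x ->
            m <= psi x <= M &
        forall x : R, closed_neighbourhood r (ifs_interval T) x ->
          diffusion alpha T psi x < psi x].
Proof.
have [_ [beta [C hC] <-]] := ereal_sup_gt halpha; rewrite lte_fin => ab.
(* The Frostman bound on a single unit ball forces [C] to be positive. *)
have C0 : 0 < C.
  have := hC 0 1 ltr01; rewrite powR1 mulr1 => h.
  by rewrite -lte_fin; apply: le_lt_trans h.
have [r r0 hr] := probability_itv_gt0 R mu (ifs_left T) (ifs_right T).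
exists r; split=> //.
pose A := ifs_left T - r; pose B := ifs_right T + r.
have hI x : closed_neighbourhood r (ifs_interval T) x <-> A <= x <= B.
  by apply: closed_neighbourhood_itv; [exact: ifs_left_le_right|exact: ltW].
have AB : A < B by rewrite /A /B; have := ifs_left_le_right T; lra.
have hinv (j : 'I_(ifs_size T)) y : A <= y <= B -> A <= ifs_map j y <= B.
  by move=> /hI/(ifs_map_closed_neighbourhood R T j)/hI.
pose gam := (alpha + beta) / 2.
have ag : alpha < gam by rewrite /gam; lra.
have gb : gam < beta by rewrite /gam; lra.
have gam0 : 0 < gam by exact: lt_trans ag.
have alg : 0 <= alpha < gam by rewrite ag ltW.
have [K [eps [theta [G [K0 e0 /andP[th0 th1] G0 hk]]]]] :=
  ifs_kernel_contract R T A B alpha gam (ltW AB) alg.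
pose lam := theta `^ (gam - alpha).
have lam0 : 0 < lam by exact: powR_gt0.
have lam1 : lam < 1.
  rewrite -[ltRHS](congr1 (@^~ (gam - alpha)) (powR1 R)).
  by rewrite gt0_ltr_powR ?subr_gt0 // nnegrE // ltW.
(* The gap [lam' - lam] is reserved for the error from distances below [rho]. *)
pose lam' := (1 + lam) / 2.
have ll : lam < lam' by rewrite /lam'; lra.
have l1 : lam' < 1 by rewrite /lam'; lra.
have D0 : 0 < B - A by rewrite subr_gt0.
have mI : measurable (`[A, B]%classic : set (measurableTypeR R)) by exact: measurable_itv.
have muI : 0 < fine (mu `[A, B]%classic).
  rewrite fine_gt0 // hr (le_lt_trans (probability_le1 _ mI)) ?ltry //.
(* This lower bound for the potential holds for every [rho <= B - A], so [rho] may be chosen in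
   terms of it. *)
pose m := profile R gam K eps (B - A) * fine (mu `[A, B]%classic).
have m0 : 0 < m by rewrite mulr_gt0 ?expR_gt0.
(* [Q] collects the constants: the error equals [Q * rho^(beta - gam)], which is small with [rho]
   since [gam < beta]. *)
pose Q := G `^ alpha * (C * G `^ beta).
have Q0 : 0 < Q by rewrite !mulr_gt0 ?powR_gt0.
have [|||rho /andP[rho0 rhoD] hrho] :=
  exists_powR_le R (beta - gam) ((lam' - lam) * m / Q) (B - A).
- by rewrite subr_gt0.
- by rewrite divr_gt0 // mulr_gt0 // subr_gt0.
- by [].
pose k := kernel R gam K eps rho.
have mk : measurable_fun [set: R] k by exact: measurable_kernel.
have kM t : 0 <= k t <= rho `^ (- gam) by apply: kernel_bounds => //; exact: ltW.
pose pot := potential R mu A B k.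
have potM x : 0 <= pot x <= rho `^ (- gam).
  by have [_ -> ->] := potential_EFin R mu A B _ k x mk kM.
have potm x : A <= x <= B -> m <= pot x.
  move=> xI; apply: (potential_ge R mu A B _ _ k x mk kM (expR_ge0 _) xI) => t /andP[t0 tD].
  by apply: profile_nincr; rewrite ?lt_max ?ge_max ?rho0 ?orbT ?tD // ltW.
pose E0 := G `^ alpha * rho `^ (- gam).
have hball z : (mu (ball z (G * rho)) <= (C * (G * rho) `^ beta)%:E)%E.
  by apply/ltW/hC; rewrite mulr_gt0.
have hE : E0 * (C * (G * rho) `^ beta) <= (lam' - lam) * m.
  have -> : E0 * (C * (G * rho) `^ beta) = Q * rho `^ (beta - gam).
    rewrite powRD; last by rewrite (gt_eqF rho0) implybT.
    by rewrite powRM ?(ltW G0) ?(ltW rho0) // /Q /E0; ring.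
  by rewrite mulrC -ler_pdivlMr.
pose psi0 z := if A <= z <= B then pot z else 0.
have hpsi0 x : A <= x <= B -> diffusion alpha T psi0 x <= lam' * pot x.
  move=> xI.
  have H := diffusion_potential_le R T mu A B (rho `^ (- gam)) lam E0 (G * rho)
    (C * (G * rho) `^ beta) alpha x k hmu hinv mk kM (ltW lam0)
    (mulr_ge0 (powR_ge0 _ _) (powR_ge0 _ _)) hball (hk rho rho0).
  (* The error is at most [(lam' - lam) * m], and [m <= pot x] turns it into a multiple of the
     potential. *)
  apply: (le_trans H); rewrite -lerBrDl -mulrBl (le_trans hE) //.
  by apply: ler_wpM2l; [rewrite subr_ge0 ltW|exact: potm].
have l01 : 0 < lam' < 1 by rewrite l1 andbT (lt_trans lam0).
have sig1 : 1 < 1 + (1 - lam') / 4 by rewrite ltrDl divr_gt0 // subr_gt0.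
(* The mesh [delta] comes last, as it depends on [rho] and on the slack left by [lam']. *)
have [|delta d0 hdelta] := kernel_slowly_varying R gam K eps rho (B - A)
  (1 + (1 - lam') / 4) (ltW gam0) K0 e0 _ sig1; first by rewrite rho0.
have hpot x x' : A <= x <= B -> `|x - x'| <= delta ->
    pot x <= (1 + (1 - lam') / 4) * pot x'.
  exact: (potential_slowly_varying R mu A B _ delta _ k x x' mk kM
    (ltW (lt_trans ltr01 sig1)) hdelta).
have [psi [h1 h2 h3 h4 h5]] := step_strict_supersolution R T A B alpha lam'
  delta m _ pot l01 d0 m0 potM potm hpot hpsi0.
exists psi; split=> //.
- by move=> x hx; apply: h3 => /hI.
- by exists m, (rho `^ (- gam)); split=> // x /hI; exact: h4.
- by move=> x /hI; exact: h5.
Qed.
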